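(* Let $M\subseteq\mathbb{T}$ satisfy the standing hypothesis. Then the complete shell of $\rho^\forall_M$ for $\oplus$ is the map $X\mapsto\{\langle i,\sigma\rangle\in M\mid\exists k\in\mathbb{N}.\ M^{-k}_{\downarrow\langle i,\sigma\rangle}\subseteq X\}$, where for $k\in\mathbb{Z}$, $M^{k}_{\downarrow\langle i,\sigma\rangle}=\{\langle j,\tau\rangle\in M\mid\tau_{j+k}=\sigma_{i+k}\}$.
   Context: $\mathbb{T}$ is the set of traces $\langle i,\sigma\rangle$, $i\in\mathbb{Z}$, $\sigma:\mathbb{Z}\to\mathbb{S}$ ($\sigma_k=\sigma(k)$); $X_{\downarrow s}=\{\langle i,\sigma\rangle\in X\mid\sigma_i=s\}$; $\oplus(X)=\{\langle i,\sigma\rangle\mid\langle i+1,\sigma\rangle\in X\}$, $\ominus(X)=\{\langle i,\sigma\rangle\mid\langle i-1,\sigma\rangle\in X\}$, $\curvearrowleft(X)=\{\langle -i,\lambda k.\sigma_{-k}\rangle\mid\langle i,\sigma\rangle\in X\}$. Standing hypothesis on $M$: (i) $|M_{\downarrow s}|>1$ for all $s$; (ii) $\oplus(M)=M=\ominus(M)$ and $\oplus(\curvearrowleft M)=\curvearrowleft M=\ominus(\curvearrowleft M)$. $\rho^\forall_M(X)=\{\langle i,\sigma\rangle\in M\mid M_{\downarrow\sigma_i}\subseteq X\}$. Upper closure operators on $\langle\wp(\mathbb{T}),\supseteq\rangle$: maps monotone w.r.t. $\subseteq$, idempotent, with $\rho(X)\subseteq X$; $\rho\sqsubseteq\eta$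 iff $\rho(X)\supseteq\eta(X)$ for all $X$. $\rho$ is complete for $f$ if $\rho\circ f=\rho\circ f\circ\rho$. The complete shell of $\rho$ for $f$ is the $\sqsubseteq$-greatest closure $\eta\sqsubseteq\rho$ complete for $f$. *)

(* Defs.v *)
From mathcomp Require Import all_boot all_order all_algebra.
From mathcomp Require Import boolp classical_sets functions cardinality.

Set Implicit Arguments.
Unset Strict Implicit.
Unset Printing Implicit Defensive.

Import GRing.Theory.
Local Open Scope ring_scope.
Local Open Scope classical_set_scope.
Local Open Scope card_scope.

Definition trace (St : Type) : Type := (int * (int -> St))%type.

Section Traces.
Variable St : Type.
Implicit Types (X M : set (trace St)) (t : trace St) (s : St).

Definition state_restr X s : set (trace St) := [set t | X t /\ t.2 t.1 = s].

Definition oplus X : set (trace St) := [set t | X (t.1 + 1, t.2)].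

Definition ominus X : set (trace St) := [set t | X (t.1 - 1, t.2)].

Definition trev X : set (trace St) :=
  [set (- t.1, fun k : int => t.2 (- k)) | t in X].

(* The first conjunct is |M_{|s}| > 1: the cardinal is not at most 1. *)
Definition model_hyp M : Prop :=
  [/\ forall s, ~ (state_restr M s #<= `I_1),
      oplus M = M /\ M = ominus M
    & oplus (trev M) = trev M /\ trev M = ominus (trev M)].

Definition rho_forall M X : set (trace St) :=
  [set t | M t /\ state_restr M (t.2 t.1) `<=` X].

Definition state_restr_at M (k : int) t : set (trace St) :=
  [set u | M u /\ u.2 (u.1 + k) = t.2 (t.1 + k)].

End Traces.

Section Closures.
Variable T : Type.
Implicit Types (rho eta f : set T -> set T).

(* Upper closure operators of the powerset ordered by SUPERSET inclusion. *)
Definition uco rho : Prop :=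
  [/\ forall X Y, X `<=` Y -> rho X `<=` rho Y,
      forall X, rho (rho X) = rho X
    & forall X, rho X `<=` X].

(* rho is below eta when rho X is below eta X for the superset order. *)
Definition uco_le rho eta : Prop := forall X, eta X `<=` rho X.

Definition complete_for f rho : Prop := rho \o f = rho \o f \o rho.

Definition is_complete_shell f rho eta : Prop :=
  [/\ uco eta, uco_le eta rho, complete_for f eta
    & forall theta, uco theta -> uco_le theta rho -> complete_for f theta ->
        uco_le theta eta].

End Closures.

(* Main.v *)
(** For an operator [theta] below the identity, completeness for [oplus] gives
    [theta (oplus X) `<=` oplus (theta X)].  The set of traces of [M] that are
    in state [s] now is a fixpoint of [rho_forall M], hence of every closure
    below it.  Shifting the set of traces that were in state [s] [k] steps ago
    by [k] yields that fixpoint, so pulling the inclusion back through the [k]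
    shifts shows that the former sets are fixpoints too.  Conversely, the inverse
    shift of such a set has the same form with [k.+1] in place of [k], which
    gives completeness of the operator they generate. *)
Require Import Defs.
From mathcomp Require Import all_boot all_order all_algebra.
From mathcomp Require Import boolp classical_sets functions cardinality.

Import GRing.Theory.
Local Open Scope ring_scope.
Local Open Scope classical_set_scope.

Lemma oplus_iter (St : Type) (X : set (trace St)) (k : nat) (t : trace St) :
  iter k (@oplus St) X t <-> X (t.1 + k%:Z, t.2).
Proof.
elim: k t => [|k IH] [i s] /=; first by rewrite addr0.
by rewrite /oplus /= (IH (i + 1, s)) /= -addrA -PoszD.
Qed.

Lemma oplus_iter_inv (St : Type) (M : set (trace St)) (k : nat) :
  oplus M = M -> iter k (@oplus St) M = M.
Proof. by move=> MM; elim: k => //= k ->. Qed.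

Lemma state_restr_at_id (St : Type) (M : set (trace St)) (k : int) (t : trace St) :
  M t -> state_restr_at M k t t.
Proof. by []. Qed.

(** The set depends on [t] only through its state at offset [k], so these sets partition [M] into
    classes. *)
Lemma state_restr_at_eq (St : Type) (M : set (trace St)) (k : int) (t u : trace St) :
  state_restr_at M k t u -> state_restr_at M k u = state_restr_at M k t.
Proof. by case=> _ E; rewrite /state_restr_at E. Qed.

Lemma oplus_iter_state_restr_at (St : Type) (M : set (trace St)) (k : nat) (t : trace St) :
  oplus M = M ->
  iter k (@oplus St) (state_restr_at M (- k%:Z) t) =
  state_restr M (t.2 (t.1 - k%:Z)).
Proof.
move=> MM; apply/seteqP; split=> u.
  by move/oplus_iter=> [/= /oplus_iter]; rewrite oplus_iter_inv // addrK.
move=> [Mu uE]; apply/oplus_iter; split; rewrite /= ?addrK //.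
by apply/oplus_iter; rewrite oplus_iter_inv.
Qed.

(** At each step completeness inserts [theta] under the outermost [f]; the outer [theta] is then
    dropped, as it only shrinks sets. *)
Lemma complete_iter_sub {T : Type} (f theta : set T -> set T) (k : nat) (X : set T) :
  (forall A B, A `<=` B -> f A `<=` f B) -> uco theta -> complete_for f theta ->
  theta (iter k f X) `<=` iter k f (theta X).
Proof.
move=> f_mono [_ _ theta_sub] theta_f; elim: k => //= k IH.
have -> : theta (f (iter k f X)) = theta (f (theta (iter k f X))).
  exact: (congr1 (fun g => g (iter k f X)) theta_f).
exact: subset_trans (theta_sub _) (f_mono _ _ IH).
Qed.

Lemma oplus_mono (St : Type) (X Y : set (trace St)) :
  X `<=` Y -> oplus X `<=` oplus Y.
Proof. by move=> XY t; apply: XY. Qed.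

(** Shifting time is a bijection on traces: the trace moved back by [k] witnesses the inclusion. *)
Lemma iter_oplus_reflects_sub (St : Type) (k : nat) (X Y : set (trace St)) :
  iter k (@oplus St) X `<=` iter k (@oplus St) Y ->
  X `<=` Y.
Proof.
move=> XY [i s] Xis; have /XY/oplus_iter : iter k (@oplus St) X (i - k%:Z, s).
  by apply/oplus_iter; rewrite /= subrK.
by rewrite /= subrK.
Qed.

Theorem theorem10 (St : Type) (M : set (trace St)) (hM : model_hyp M) :
  is_complete_shell (@oplus St) (rho_forall M)
    (fun X : set (trace St) =>
       [set t | M t /\ exists k : nat, state_restr_at M (- k%:Z) t `<=` X]).
Proof.
case: hM => _ [Mplus Mminus] _.
set eta := (X in is_complete_shell _ _ X).
have eta_mono X Y : X `<=` Y -> eta X `<=` eta Y.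
  by move=> XY t [Mt [k kX]]; split=> //; exists k; apply: subset_trans XY.
have eta_sub X : eta X `<=` X.
  by move=> t [Mt [k]]; apply; apply: state_restr_at_id.
(* All members of a class share that class, so one [k] serves them all; idempotence follows. *)
have eta_at X k t : state_restr_at M (- k%:Z) t `<=` X ->
    state_restr_at M (- k%:Z) t `<=` eta X.
  move=> kX u ut; split; first by case: ut.
  by exists k; rewrite (state_restr_at_eq _ _ _ _ _ ut).
split.
- split=> // X; apply/seteqP; split; first exact: eta_sub.
  by move=> t [Mt [k /eta_at kX]]; split=> //; exists k.
- move=> X t [Mt tX]; split=> //; exists 0%N => u [Mu].
  by rewrite oppr0 !addr0 => uE; apply: tX.
- apply/funext => X; apply/seteqP; split; last first.
    by apply: eta_mono; apply: oplus_mono; apply: eta_sub.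
  move=> t [Mt [k kX]]; split=> //; exists k => -[j s] js /=.
  split; first by case: js => Mjs _; rewrite -Mplus in Mjs.
  (* The trace to treat is [(j + 1, s)]: looking back [k.+1] steps from [j + 1] reaches the same
     instant as [k] steps from [j]. *)
  exists k.+1 => -[j' s'] [Mu' /=].
  have shift (a : int) : a - k.+1%:Z = a - 1 - k%:Z.
    by rewrite -addrA -opprD -PoszD add1n.
  rewrite !shift addrK => E.
  suff /kX : state_restr_at M (- k%:Z) t (j' - 1, s').
    by rewrite /oplus /= subrK.
  split; first by rewrite Mminus in Mu'.
  by rewrite /= E; case: js.
- move=> theta theta_uco theta_rho theta_c X t [Mt [k kX]].
  case: (theta_uco) => theta_mono _ _.
  apply: (theta_mono _ _ kX).
  suff sub : state_restr_at M (- k%:Z) t `<=` theta (state_restr_at M (- k%:Z) t).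
    exact/sub/state_restr_at_id.
  apply: (@iter_oplus_reflects_sub _ k).
  apply: subset_trans (complete_iter_sub _ _ _ _ (@oplus_mono St) theta_uco theta_c).
  rewrite oplus_iter_state_restr_at //.
  (* Membership in [rho_forall M] of this set depends only on the present state, which [u] shares
     with the whole set. *)
  apply: subset_trans (theta_rho _) => u [Mu uE].
  by split=> //; rewrite uE.
Qed.
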